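(* Let $X$ be a nonempty completely regular Hausdorff space. The following statements are equivalent: (1) $X$ is almost locally pseudocompact; (2) $C_\psi(X)$ is an essential ideal of $C(X)$; (3) $C^\psi_\infty(X)$ is an essential ideal of $C^*(X)$.
   Context: $C(X)$ is the ring of all real-valued continuous functions on $X$ and $C^*(X)$ its subring of bounded functions; $Z(f)=\{x\in X: f(x)=0\}$. A space is pseudocompact if every real-valued continuous function on it is bounded. $C_\psi(X)=\{f\in C(X): \mathrm{cl}_X(X\setminus Z(f))\text{ is pseudocompact}\}$ and $C^\psi_\infty(X)=\{f\in C(X): \mathrm{cl}_X\{x\in X: |f(x)|>\epsilon\}\text{ is pseudocompact for each }\epsilon>0\}$. $X$ is almost locally pseudocompact if each nonempty open set $U$ in $X$ contains a nonempty open set $V$ such that $\mathrm{cl}_X V$ is pseudocompact. A nonzero (not necessarily proper) ideal $I$ in a commutative ring $R$ is essential if it intersects each nonzero ideal of $R$ nontrivially. *)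

(* Defs.v *)
From HB Require Import structures.
From mathcomp Require Import all_boot all_order all_algebra.
From mathcomp Require Import all_classical all_reals all_analysis.

Set Implicit Arguments.
Unset Strict Implicit.
Unset Printing Implicit Defensive.

Import Order.TTheory GRing.Theory Num.Theory.
Import numFieldNormedType.Exports.

Local Open Scope classical_set_scope.
Local Open Scope ring_scope.

Section ideals.
Context {A : comPzRingType}.
Implicit Types I J : set A.

(* Ideals need not be proper, unlike those of [ring_quotient]. *)
Definition is_ideal I : Prop :=
  [/\ I 0, forall x y, I x -> I y -> I (x + y)
    & forall a x, I x -> I (a * x)].

Definition essential_ideal I : Prop :=
  [/\ is_ideal I, I <> [set 0]
    & forall J, is_ideal J -> J <> [set 0] -> I `&` J <> [set 0]].

End ideals.

(* C(X): the type [continuousType X R], as a subring of the ring of all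
   functions [X -> R] with pointwise operations. *)
Section continuous_ring.
Context {X : topologicalType} {R : realType}.

Definition cont_pred : {pred X -> R} := mem [set f : X -> R | continuous f].

Section Sub.
Context (f : X -> R) (fP : f \in cont_pred).
Definition cont_Sub_subproof := @isContinuous.Build X R f (set_mem fP).
#[local] HB.instance Definition _ := cont_Sub_subproof.
Definition cont_Sub : continuousType X R := f.
End Sub.

Lemma cont_rect (K : continuousType X R -> Type) :
  (forall f (Pf : f \in cont_pred), K (cont_Sub Pf)) ->
  forall u : continuousType X R, K u.
Proof.
move=> Ksub [f [[Pf]]]/=.
by suff -> : Pf = set_mem (@mem_set _ [set f | _] f Pf) by apply: Ksub.
Qed.

Lemma cont_valP f (Pf : f \in cont_pred) : cont_Sub Pf = f :> (_ -> _).
Proof. by []. Qed.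

HB.instance Definition _ :=
  isSub.Build _ _ (continuousType X R) cont_rect cont_valP.

Lemma cont_subring_closed : subring_closed cont_pred.
Proof.
split=> [|f g|f g]; rewrite !inE/=.
- by move=> x; exact: cvg_cst.
- by move=> cf cg x; apply: cvgB; [exact: cf|exact: cg].
- by move=> cf cg x; apply: cvgM; [exact: cf|exact: cg].
Qed.

HB.instance Definition _ := GRing.SubChoice_isSubComPzRing.Build
  (X -> R) cont_pred (continuousType X R) cont_subring_closed.

Implicit Types f g : continuousType X R.

Lemma cont0E : (0 : continuousType X R) = cst 0 :> (X -> R).
Proof. by []. Qed.
Lemma cont1E : (1 : continuousType X R) = cst 1 :> (X -> R).
Proof. by []. Qed.
Lemma contDE f g : f + g = f \+ g :> (X -> R). Proof. by []. Qed.
Lemma contNE f : - f = \- f :> (X -> R). Proof. by []. Qed.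
Lemma contME f g : f * g = f \* g :> (X -> R). Proof. by []. Qed.

End continuous_ring.

(* C^*(X) *)
Section bounded_continuous_ring.
Context (X : topologicalType) (R : realType).

Definition bounded_cont : {pred continuousType X R} :=
  mem [set f : continuousType X R | bounded_fun (f : X -> R)].

Lemma bounded_contP (f : continuousType X R) :
  f \in bounded_cont <-> exists M : R, forall x, `|f x| <= M.
Proof.
rewrite inE; split=> [[M [_ /(_ (M + 1))]]|[M fM]].
  by rewrite ltrDl ltr01 => /(_ isT) hM; exists (M + 1) => x; exact: hM.
exists M; split; first exact: num_real.
by move=> N /ltW MN x _; exact: le_trans (fM x) MN.
Qed.

Lemma bounded_cont_subring_closed : subring_closed bounded_cont.
Proof.
split=> [|f g /bounded_contP[M fM] /bounded_contP[N gN]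
         |f g /bounded_contP[M fM] /bounded_contP[N gN]]; apply/bounded_contP.
- by exists 1 => x; rewrite cont1E normr1.
- exists (M + N) => x.
  exact: le_trans (ler_normB (f x) (g x)) (lerD (fM x) (gN x)).
- by exists (M * N) => x; rewrite contME normrM ler_pM.
Qed.

Definition boundedContinuous := {f : continuousType X R | f \in bounded_cont}.

HB.instance Definition _ := SubChoice.on boundedContinuous.
HB.instance Definition _ := GRing.SubChoice_isSubComPzRing.Build
  (continuousType X R) bounded_cont boundedContinuous
  bounded_cont_subring_closed.

End bounded_continuous_ring.

Arguments bounded_cont : clear implicits.

Section pseudocompactness.
Context (R : realType).

Definition pseudocompact (T : topologicalType) : Prop :=
  forall f : T -> R, continuous f -> bounded_fun f.

Context (X : topologicalType).

(* A subset is coerced to its subtype, which carries the relative topology. *)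
Definition almost_locally_pseudocompact : Prop :=
  forall U : set X, open U -> U !=set0 ->
    exists V : set X,
      [/\ open V, V !=set0, V `<=` U & pseudocompact (closure V)].

Definition zero_set (f : X -> R) : set X := [set x | f x = 0].

Definition C_psi : set (continuousType X R) :=
  [set f | pseudocompact (closure (~` zero_set f))].

Definition C_psi_infty : set (continuousType X R) :=
  [set f | forall e : R, 0 < e -> pseudocompact (closure [set x | e < `|f x|])].

End pseudocompactness.

Arguments C_psi : clear implicits.
Arguments C_psi_infty : clear implicits.

(* Main.v *)
Require Import Defs.
From HB Require Import structures.
From mathcomp Require Import all_boot all_order all_algebra.
From mathcomp Require Import all_classical all_reals all_analysis.
From mathcomp Require Import lra.

Import Order.TTheory GRing.Theory Num.Theory.
Import numFieldNormedType.Exports.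

Local Open Scope classical_set_scope.
Local Open Scope ring_scope.

(** Over a completely regular space, the closure of an open set [U] is
    pseudocompact as soon as every [h] in [C(X)] is bounded on [U]: if a
    continuous [f] on [cl U] is unbounded, then the open sets
    [U `&` {k < |f|}] are nonempty and locally finite in the whole of [X], so
    the sum of [k] times a bump function supported in the [k]-th one is a
    function in [C(X)] that is unbounded on [U].  Membership in [C_psi] and in
    [C_psi_infty] thus becomes a condition on cozero sets that passes to
    subsets and finite unions, whence both are ideals.  Essentiality may be
    tested on principal ideals: multiplying [g] by a bump function supported in
    a small open subset of its cozero set lands in both ideals, and conversely
    a nonzero multiple of a bump function supported in [U] provides the
    open set required inside [U]. *)

(** * Locally finite sums and bump functions *)

Lemma locally_finite_sum_continuous (R : realType) (X : topologicalType)
    (h : nat -> X -> R) :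
    (forall k, continuous (h k)) ->
    (forall y : X, exists m, \forall x \near y,
      forall k, (m <= k)%N -> h k x = 0) ->
  exists2 s : X -> R, continuous s &
    forall x m, (forall k, (m <= k)%N -> h k x = 0) ->
      s x = \sum_(0 <= k < m) h k x.
Proof.
move=> hC /choice[m hm].
have sumE x p q : (forall k, (p <= k)%N -> h k x = 0) ->
    (forall k, (q <= k)%N -> h k x = 0) ->
    \sum_(0 <= k < p) h k x = \sum_(0 <= k < q) h k x.
  wlog pq : p q / (p <= q)%N => [W hp hq|hp _].
    by case/orP: (leq_total p q) => ?; [|symmetry]; apply: W.
  rewrite [RHS](@big_cat_nat _ _ _ p)//= [X in _ + X]big_nat_cond.
  rewrite [X in _ + X]big1 ?addr0//.
  by move=> k /andP[/andP[/hp]].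
(* The cutoff [m x] need not vary continuously, but by [sumE] any two valid cutoffs give the same
   sum. Near [y] the single cutoff [m y] is valid, so [s] is there a fixed finite sum. *)
pose s x := \sum_(0 <= k < m x) h k x.
have sE x p : (forall k, (p <= k)%N -> h k x = 0) ->
    s x = \sum_(0 <= k < p) h k x.
  by move=> hp; apply: sumE => // k; exact: (nbhs_singleton (hm x)).
exists s => // y; rewrite /continuous_at (sE y (m y)); last first.
  exact: (nbhs_singleton (hm y)).
apply: (@cvg_trans _ ((fun x => \sum_(0 <= k < m y) h k x) @ y)).
  apply: near_eq_cvg; near=> x; apply/esym/sE.
  by near: x; exact: hm.
by apply: cvg_big => [|k _]; [exact: add_continuous|exact: hC].
Unshelve. all: by end_near. Qed.

Lemma completely_regular_bump (R : realType) (X : topologicalType)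
    (U : set X) (p : X) :
    completely_regular_space X -> open U -> U p ->
  exists b : X -> R, [/\ continuous b, b p = 1, forall x, 0 <= b x <= 1
    & forall x, ~ U x -> b x = 0].
Proof.
move=> crX oU Up.
have [|/= f [fC f01 fp fU]] := (uniform_separatorP (R := R) _ _).1
  (crX p (~` U) (open_closedC oU) _).
  by move=> /(_ Up).
exists (fun x => 1 - f x); split.
- by move=> x; apply: cvgB; [exact: cvg_cst|exact: fC].
- by rewrite (fp (f p)) ?subr0//; exists p.
- move=> x; have : `[0, 1]%classic (f x) by apply: f01; exists x.
  by rewrite /= in_itv/= => /andP[? ?]; lra.
- by move=> x nUx; rewrite (fU (f x)) ?subrr//; exists x.
Qed.

(** * Pseudocompactness of closures of open sets *)

Definition relatively_pseudocompact (R : realType) (X : topologicalType)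
    (U : set X) :=
  forall h : X -> R, continuous h -> exists M : R, forall x, U x -> `|h x| <= M.

Lemma bounded_fun_normP (R : realType) (T : Type) (f : T -> R) :
  bounded_fun f <-> exists M : R, forall x, `|f x| <= M.
Proof.
split=> [[M [_ /(_ (M + 1))]]|[M fM]].
  by rewrite ltrDl ltr01 => /(_ isT) hM; exists (M + 1) => x; exact: hM.
exists M; split; first exact: num_real.
by move=> N /ltW MN x _; exact: le_trans (fM x) MN.
Qed.

Lemma pseudocompact_setP (R : realType) (X : topologicalType) (A : set X) :
  pseudocompact R A <->
  forall f : X -> R, {within A, continuous f} ->
    exists M : R, forall x, A x -> `|f x| <= M.
Proof.
split=> [pA f /subspace_sigL_continuousP /pA /bounded_fun_normP[M fM]|bA f].
  by exists M => x Ax; exact: (fM (exist _ x (mem_set Ax))).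
(* [valLK 0] presents [f] as the restriction of its extension by the default value 0 outside [A]. *)
rewrite -[f](valLK 0) => /subspace_sigL_continuousP /bA[M fM].
by apply/bounded_fun_normP; exists M => x; exact: fM (set_valP x).
Qed.

(** The points of the closure where [M < |f|] form a relatively open set, which would meet [U] if it
    were nonempty. *)
Lemma within_bounded_closure (R : realType) (X : topologicalType)
    (U : set X) (f : X -> R) (M : R) :
    {within closure U, continuous f} -> (forall x, U x -> `|f x| <= M) ->
  forall x, closure U x -> `|f x| <= M.
Proof.
move=> /subspace_continuousP fC fM y cUy; rewrite leNgt; apply/negP => Mfy.
have : \forall x \near within (closure U) (nbhs y), M < `|f x|.
  exact: (cvgr_gt _ (cvg_norm (fC y cUy)) _ Mfy).
move=> /cUy[x [Ux /(_ (subset_closure Ux))]] /=.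
by rewrite ltNge fM.
Qed.

Lemma pseudocompact_closureP (R : realType) (X : topologicalType) (U : set X) :
    completely_regular_space X -> open U ->
  pseudocompact R (closure U) <-> relatively_pseudocompact R X U.
Proof.
move=> crX oU; rewrite pseudocompact_setP; split=> [pU h hC|pU f fC].
  have [M hM] := pU h (continuous_subspaceT hC).
  by exists M => x Ux; exact/hM/subset_closure.
apply: contrapT => funb.
pose V (k : nat) := [set x | U x /\ k%:R < `|f x|].
have fCx := (subspace_continuousP _ f).1 fC.
have oV k : open (V k).
  (* Continuity of [f] is known only within the closure; since [U] is open, this suffices at points
     of [U]. *)
  rewrite openE => y [Uy ky]; have cUy := subset_closure Uy.
  have := cvgr_gt _ (cvg_norm (fCx y cUy)) _ ky.
  move=> Hy; have Uny : nbhs y U by exact: open_nbhs_nbhs.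
  rewrite /interior; near=> x; have Ux : U x by near: x.
  split=> //; have := subset_closure Ux; near: x; exact: Hy.
have V0 k : exists x, V k x.
  apply: contrapT => noV; apply: funb; exists k%:R.
  apply: within_bounded_closure => // x Ux; rewrite leNgt.
  by apply/negP => kx; apply: noV; exists x.
have [x Vx] := choice V0.
have [b bP] := choice (fun k => completely_regular_bump R X (V k) (x k) crX
  (oV k) (Vx k)).
have [||s sC sE] := @locally_finite_sum_continuous R X
  (fun k y => k%:R * b k y).
- move=> k y; apply: cvgM; first exact: cvg_cst.
  by have [bC _ _ _] := bP k; exact: bC.
- move=> y; have [cUy|ncUy] := pselect (closure U y).
    (* Near [y], [|f| < |f y| + 1] on [U], so no [V k] with [k] beyond this integer comes near [y].
       Outside the closure the cutoff 0 works. *)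
    exists (Num.trunc (`|f y| + 1)).+1.
    have fy1 : `|f y| < `|f y| + 1 by rewrite ltrDl.
    have fy := cvgr_lt _ (cvg_norm (fCx y cUy)) _ fy1.
    near=> z => k yk; have [_ _ _ ->] := bP k; rewrite ?mulr0// => -[Uz].
    apply/negP; rewrite -leNgt.
    have fz : `|f z| < `|f y| + 1.
      by have := subset_closure Uz; near: z; exact: fy.
    apply/ltW/(lt_le_trans fz)/(le_trans (ltW (truncnS_gt _))).
    by rewrite ler_nat.
  exists 0%N; have : nbhs y (~` closure U).
    by apply: open_nbhs_nbhs; split=> //; exact/closed_openC/closed_closure.
  apply: filterS => z ncUz k _; have [_ _ _ ->] := bP k; rewrite ?mulr0//.
  by move=> [/subset_closure].
have [M sM] := pU s sC.
pose k := (Num.trunc M).+1; have [Uxk kxk] := Vx k.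
have := sM _ Uxk; apply/negP; rewrite -ltNge.
apply: (lt_le_trans (truncnS_gt M)); rewrite -/k.
(* Large enough to include the [k]-th term and to leave out only [j] with [|f (x k)| < j]. All terms
   are nonnegative and the [k]-th equals [k > M]. *)
pose m := (maxn k (Num.trunc `|f (x k)|)).+1.
rewrite (sE _ m); last first.
  move=> j mj; have [_ _ _ ->] := bP j; rewrite ?mulr0// => -[_].
  apply/negP; rewrite -leNgt; apply/ltW/(lt_le_trans (truncnS_gt _)).
  by rewrite ler_nat (leq_trans _ mj)// ltnS leq_maxr.
apply: le_trans (ler_norm _).
rewrite big_mkord (bigD1 (inord k))//= inordK ?ltnS ?leq_maxl//.
have [_ -> _ _] := bP k; rewrite mulr1 lerDl sumr_ge0// => j _.
by have [_ _ /(_ (x k))/andP[b0 _] _] := bP j; rewrite mulr_ge0.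
Unshelve. all: by end_near. Qed.

(** * Essential ideals *)

Lemma essential_idealP (A : comPzRingType) (I : set A) :
    (1 : A) <> 0 -> is_ideal I ->
  essential_ideal I <-> forall g, g <> 0 -> exists2 a, I (a * g) & a * g <> 0.
Proof.
move=> A1 idI; split=> [[_ _ essI] g g0|essI].
  pose J := [set a * g | a in [set: A]].
  have idJ : is_ideal J.
    split; first by exists 0; rewrite ?mul0r.
    - by move=> _ _ [a _ <-] [b _ <-]; exists (a + b); rewrite ?mulrDl.
    - by move=> b _ [a _ <-]; exists (b * a); rewrite ?mulrA.
  apply: contrapT => noa; apply: (essI J idJ).
    move=> J0; apply: g0; have : J g by exists 1; rewrite ?mul1r.
    by rewrite J0.
  apply/seteqP; split=> [y [Iy [a _ ag]]|_ ->]; last first.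
    by case: idI => I0 _ _; split=> //; case: idJ.
  by apply: contrapT => y0; apply: noa; exists a; rewrite ag.
split=> //.
  (* The case [g = 1] provides a nonzero element of [I]. *)
  by move=> I0; have [a] := essI 1 A1; rewrite I0.
move=> J [J0 _ JM] Jn0 IJ0.
have [g Jg g0] : exists2 g, J g & g <> 0.
  apply: contrapT => noJ; apply: Jn0; apply/seteqP; split=> [g Jg|_ ->//].
  by apply: contrapT => g0; apply: noJ; exists g.
have [a Iag ag0] := essI g g0; apply: ag0.
have : (I `&` J) (a * g) by split=> //; exact: JM.
by rewrite IJ0.
Qed.

(** * The two ideals and their essentiality *)

Section continuous_functions.
Context (R : realType) (X : topologicalType).
Implicit Types (f g : continuousType X R) (U V : set X).

Lemma cont_neq0P f : f <> 0 <-> exists x, f x <> 0.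
Proof.
split=> [f0|[x fx0] f0]; last by rewrite f0 in fx0.
apply: contrapT => nof; apply/f0/val_inj/funext => x.
by apply: contrapT => fx0; apply: nof; exists x.
Qed.

Lemma open_cozero f : open (~` zero_set f).
Proof.
rewrite (_ : ~` _ = f @^-1` [set~ 0]); last by apply/seteqP; split.
by apply: open_comp => [x _|]; [exact: cts_fun|exact/closed_openC/closed_eq].
Qed.

Lemma open_norm_gt f (e : R) : open [set x | e < `|f x|].
Proof.
rewrite (_ : [set _ | _] = (fun x => `|f x|) @^-1` [set y | e < y]) //.
apply: open_comp; last exact: open_gt.
by move=> x _; apply: cvg_norm; exact: cts_fun.
Qed.

Lemma relatively_pseudocompactS U V :
  U `<=` V -> relatively_pseudocompact R X V -> relatively_pseudocompact R X U.
Proof. by move=> UV pV h /pV[M hM]; exists M => x /UV /hM. Qed.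

Lemma relatively_pseudocompactU U V :
  relatively_pseudocompact R X U -> relatively_pseudocompact R X V ->
  relatively_pseudocompact R X (U `|` V).
Proof.
move=> pU pV h hC; have [M hM] := pU h hC; have [N hN] := pV h hC.
by exists (Num.max M N) => x [/hM|/hN] hx; rewrite le_max hx ?orbT.
Qed.

Hypothesis crX : completely_regular_space X.

Lemma C_psiP f :
  C_psi R X f <-> relatively_pseudocompact R X (~` zero_set f).
Proof. exact: (pseudocompact_closureP _ _ _ crX (open_cozero f)). Qed.

Lemma C_psi_inftyP f : C_psi_infty R X f <->
  forall e : R, 0 < e -> relatively_pseudocompact R X [set x | e < `|f x|].
Proof.
by split=> pf e e0; apply/(pseudocompact_closureP _ _ _ crX (open_norm_gt f e));
  exact: pf.
Qed.

Lemma C_psi_sub_infty f : C_psi R X f -> C_psi_infty R X f.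
Proof.
move=> /C_psiP pf; apply/C_psi_inftyP => e e0.
apply: relatively_pseudocompactS pf => x /= efx f0.
by move: efx; rewrite f0 normr0 ltNge (ltW e0).
Qed.

Lemma C_psi_ideal : is_ideal (C_psi R X).
Proof.
split.
- by apply/C_psiP => h _; exists 0 => x [].
- move=> f g /C_psiP pf /C_psiP pg; apply/C_psiP.
  apply: relatively_pseudocompactS (relatively_pseudocompactU _ _ pf pg) => x.
  move=> /= fg0; have [f0|] := pselect (f x = 0); [right => g0|by left].
  by apply: fg0; rewrite /zero_set /= -[LHS]/(f x + g x) f0 g0 addr0.
- move=> a f /C_psiP; rewrite !C_psiP; apply: relatively_pseudocompactS => x.
  move=> /= af0 f0; apply: af0.
  by rewrite /zero_set /= -[LHS]/(a x * f x) f0 mulr0.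
Qed.

(** Test the set [1 < |f|] against [f] itself; elsewhere [|f|] is at most 1. *)
Lemma C_psi_infty_bounded f : C_psi_infty R X f -> f \in bounded_cont X R.
Proof.
move=> /C_psi_inftyP /(_ 1 ltr01 f (@cts_fun _ _ f)) [M fM].
apply/bounded_contP; exists (Num.max M 1) => x; rewrite le_max.
by apply/orP; have [/fM|] := ltP 1 `|f x|; [left|right].
Qed.

Lemma C_psi_infty_ideal :
  is_ideal [set f : boundedContinuous X R | C_psi_infty R X (\val f)].
Proof.
split=> /=.
- by apply: C_psi_sub_infty; case: C_psi_ideal.
- move=> f g /C_psi_inftyP pf /C_psi_inftyP pg; apply/C_psi_inftyP => e e0.
  have e20 : 0 < e / 2 by rewrite divr_gt0.
  apply: relatively_pseudocompactS
    (relatively_pseudocompactU _ _ (pf _ e20) (pg _ e20)) => x /=.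
  rewrite -[X in `|X|]/(val f x + val g x) => efg.
  have [fx|] := ltP (e / 2) `|val f x|; [by left|right].
  rewrite /= ltNge; apply/negP => gx; move: efg; apply/negP; rewrite -leNgt.
  by rewrite (splitr e); apply: le_trans (ler_normD _ _) (lerD _ _).
- move=> a f /C_psi_inftyP pf; apply/C_psi_inftyP => e e0.
  have /bounded_contP[M aM] := valP a.
  (* A positive bound for [a]: then [e < |a f|] forces [e / (|M| + 1) < |f|]. *)
  have M0 : 0 < `|M| + 1 by rewrite ltr_wpDl.
  apply: relatively_pseudocompactS (pf _ (divr_gt0 e0 M0)) => x /=.
  rewrite -[X in `|X|]/(val a x * val f x) normrM ltr_pdivrMr// mulrC.
  move=> /lt_le_trans; apply.
  rewrite ler_wpM2l//; apply: le_trans (aM x) _.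
  by rewrite (le_trans (ler_norm M))// lerDl.
Qed.

Lemma bounded_cont_bump U (p : X) : open U -> U p ->
  exists b : boundedContinuous X R,
    sval b p = 1 /\ forall x, ~ U x -> sval b x = 0.
Proof.
move=> oU Up.
have [b [bC bp b01 bU]] := completely_regular_bump R X U p crX oU Up.
pose b' : continuousType X R := cont_Sub (mem_set bC).
have bB : b' \in bounded_cont X R.
  apply/bounded_contP; exists 1 => y.
  by have /andP[b0 b1] := b01 y; rewrite ger0_norm.
by exists (exist _ b' bB).
Qed.

(** The multiplier is bounded so that it serves in both rings. *)
Lemma almost_locally_pseudocompact_mul g :
    almost_locally_pseudocompact R X -> g <> 0 ->
  exists b : boundedContinuous X R, C_psi R X (val b * g) /\ val b * g <> 0.
Proof.
move=> aX /cont_neq0P[x gx0].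
have [|V [oV [p Vp] Vg pV]] := aX _ (open_cozero g); first by exists x.
have [b [bp bV]] := bounded_cont_bump V p oV Vp.
exists b; split => /=; last first.
  apply/cont_neq0P; exists p; rewrite -[LHS]/(sval b p * g p) bp mul1r.
  exact: Vg Vp.
apply/C_psiP.
have := (pseudocompact_closureP _ _ _ crX oV).1 pV.
apply: relatively_pseudocompactS => y.
move=> /= bg0; apply: contrapT => nVy.
by apply: bg0; rewrite /zero_set /= -[LHS]/(sval b y * g y) bV ?mul0r.
Qed.

(** Leaving [I] arbitrary covers both ideals at once; only bounded [g] are tested because the bump
    function is bounded. *)
Lemma essential_mul_almost_locally_pseudocompact
    (I : set (continuousType X R)) :
    (forall f, I f -> C_psi_infty R X f) ->
    (forall g : boundedContinuous X R, val g <> 0 ->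
      exists2 a : continuousType X R, I (a * val g) & a * val g <> 0) ->
  almost_locally_pseudocompact R X.
Proof.
move=> Ipsi essI U oU [p Up].
have [b [bp bU]] := bounded_cont_bump U p oU Up.
have [|a /Ipsi pab /cont_neq0P[q abq]] := essI b.
  by apply/cont_neq0P; exists p; rewrite /= bp; exact/eqP/oner_neq0.
(* Half the value at [q] keeps [q] in the set [e < |a b|], which lies in [U] because [b] vanishes
   outside [U]. *)
pose e := `|(a * sval b) q| / 2.
have abq0 : 0 < `|(a * sval b) q| by rewrite normr_gt0; exact/eqP.
have e0 : 0 < e by rewrite divr_gt0.
exists [set x | e < `|(a * sval b) x|]; split.
- exact: open_norm_gt.
- by exists q; rewrite /= /e ltr_pdivrMr// ltr_pMr// ltr1n.
- move=> x /= ex; apply: contrapT => nUx; move: ex.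
  rewrite -[X in `|X|]/(a x * sval b x) bU//.
  by rewrite mulr0 normr0 ltNge (ltW e0).
- exact: pab.
Qed.

End continuous_functions.

Theorem theorem4p6 (R : realType) (X : topologicalType)
    (X_neq0 : [set: X] !=set0)
    (X_cr : completely_regular_space X)
    (X_hausdorff : hausdorff_space X) :
  [<-> almost_locally_pseudocompact R X;
       essential_ideal (C_psi R X);
       C_psi_infty R X `<=` [set f : continuousType X R | f \in bounded_cont X R]
       /\ essential_ideal
            [set f : boundedContinuous X R | C_psi_infty R X (\val f)]].
Proof.
have C1 : (1 : continuousType X R) <> 0.
  by have [x _] := X_neq0; apply/cont_neq0P; exists x; exact/eqP/oner_neq0.
have B1 : (1 : boundedContinuous X R) <> 0 by move=> /(congr1 val).
have psiE := essential_idealP _ _ C1 (C_psi_ideal _ _ X_cr).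
have psiooE := essential_idealP _ _ B1 (C_psi_infty_ideal R _ X_cr).
tfae.
- move=> aX; apply/psiE => g g0.
  have [b [? ?]] := almost_locally_pseudocompact_mul _ _ X_cr g aX g0.
  by exists (val b).
- move=> /psiE ess; split; first exact: C_psi_infty_bounded.
  (* Essentiality in the larger ring is not transferred directly: it first gives back almost local
     pseudocompactness, which supplies bounded multipliers. *)
  have aX : almost_locally_pseudocompact R X.
    apply: (essential_mul_almost_locally_pseudocompact _ _ X_cr (C_psi R X)).
      exact: C_psi_sub_infty.
    by move=> g; exact: ess.
  apply/psiooE => g g0.
  have [|b [pbg bg0]] := almost_locally_pseudocompact_mul _ _ X_cr (val g) aX.
    by move=> vg0; apply/g0/val_inj.
  exists b; first exact: C_psi_sub_infty.
  by move=> /(congr1 val).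
- move=> [_ /psiooE ess].
  apply: (essential_mul_almost_locally_pseudocompact
    _ _ X_cr (C_psi_infty R X)) => //.
  move=> g g0; have [|a /= pag ag0] := ess g.
    by move=> gE; apply: g0; rewrite gE.
  exists (sval a); first exact: pag.
  by move=> ag; apply: ag0; exact: val_inj.
Qed.
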